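(* Let $f:\mathbb{R}^n\to\mathbb{R}$ be twice differentiable at $\boldsymbol{x}_k$, with $\boldsymbol{g}=\nabla f(\boldsymbol{x}_k)\neq\boldsymbol 0$ and $\boldsymbol{B}=\nabla^2 f(\boldsymbol{x}_k)$ positive definite, let $\sigma\ge0$, and let $$p_k(\boldsymbol{s})=f(\boldsymbol{x}_k)+\boldsymbol{g}^\top\boldsymbol{s}+\tfrac12\boldsymbol{s}^\top\boldsymbol{B}\boldsymbol{s}+\tfrac{\sigma}{3}\|\boldsymbol{s}\|^3 .$$ Let $\boldsymbol{s}_1\neq\boldsymbol{s}_2$ be unit vectors in $\mathbb{R}^n$. For $\mathcal{W}\subseteq\mathbb{R}^n$ let $\mathcal{S}_{\mathcal W}=\mathrm{span}\bigl\{\bigcup_{\boldsymbol{s}\in\mathcal{W}}\nabla p_k(\boldsymbol{s})\bigr\}$ (the second type of subspace), i.e. the linear span of all the vectors $\nabla p_k(\boldsymbol s)$, $\boldsymbol s\in\mathcal W$. Then: 1. If $\mathcal{W}=\mathcal{B}(\boldsymbol{0};1)\subseteq\mathbb{R}^n$, then $\mathcal{S}_{\mathcal W}=\mathbb{R}^n$. 2. If $\mathcal{W}=\mathrm{span}\{\nabla p_k(\boldsymbol{0})\}$, then $\mathcal{S}_{\mathcal W}\cong\mathbb{R}^1$ or $\mathcal{S}_{\mathcal W}\cong\mathbb{R}^2$. 3. If $\mathcal{W}=\mathrm{span}\{\boldsymbol{s}_1\}\cup\mathrm{span}\{\boldsymbol{s}_2\}$, then $\mathcal{S}_{\mathcal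 W}\cong\mathbb{R}^d$ for some $d\le5$. 4. If $\mathcal{W}=\mathrm{span}\{\boldsymbol{s}_1,\boldsymbol{s}_2\}$, then $\mathcal{S}_{\mathcal W}\cong\mathbb{R}^d$ for some $d\le5$.
   Context: $\mathcal{B}(\boldsymbol{0};1)$ is the open Euclidean unit ball. $\cong$ means linear isomorphism. *)

(* Defs.v *)
From HB Require Import structures.
From mathcomp Require Import all_boot all_order all_algebra.
From mathcomp Require Import all_classical all_reals all_analysis.

Set Implicit Arguments.
Unset Strict Implicit.
Unset Printing Implicit Defensive.

Import Order.TTheory GRing.Theory Num.Theory.
Import numFieldNormedType.Exports.

Local Open Scope classical_set_scope.
Local Open Scope ring_scope.

Section Defs.
Context {R : realType} {n : nat}.
Implicit Types (f : 'cV[R]_n -> R) (x s v g : 'cV[R]_n) (B : 'M[R]_n).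

(* The library norm `|v| on matrices is the sup norm. It induces the same
   topology, hence the same notion of differentiability, as enorm. *)
Definition enorm v : R := Num.sqrt (\sum_i v i 0 ^+ 2).

Definition eball x (r : R) : set 'cV[R]_n := [set v | enorm (v - x) < r].

Definition gradient f x : 'cV[R]_n := \col_i 'D_(delta_mx i 0) f x.

(* The Jacobian matrix of the gradient. *)
Definition hessian f x : 'M[R]_n :=
  \matrix_(i, j) 'D_(delta_mx j 0) (fun y => gradient f y i 0) x.

Definition twice_differentiable f x : Prop :=
  (\forall y \near x, differentiable f y) /\ differentiable (gradient f) x.

(* Symmetry is not required here: it is automatic for the Hessian of a twice
   differentiable function. *)
Definition positive_definite B : Prop :=
  forall v, v != 0 -> 0 < (v^T *m B *m v) 0 0.

Definition cubic_model (c : R) g B (sigma : R) s : R :=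
  c + (g^T *m s) 0 0 + 2^-1 * (s^T *m B *m s) 0 0
    + sigma / 3 * enorm s ^+ 3.

(* W is an arbitrary, possibly infinite, set. *)
Definition lin_span (W : set 'cV[R]_n) : set 'cV[R]_n :=
  [set v | exists (k : nat) (a : 'I_k -> R) (u : 'I_k -> 'cV[R]_n),
     (forall i, W (u i)) /\ v = \sum_i a i *: u i].

Definition gradient_span (p : 'cV[R]_n -> R) (W : set 'cV[R]_n) :
  set 'cV[R]_n := lin_span (gradient p @` W).

(* S is a linear subspace isomorphic to R^d. *)
Definition isomorphic_to_Rd (S : set 'cV[R]_n) (d : nat) : Prop :=
  exists phi : {linear 'cV[R]_d -> 'cV[R]_n}, set_bij [set: 'cV[R]_d] S phi.

End Defs.

(* Main.v *)
(* With A = (B + B^T) / 2, the gradient of the model is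
   g + A s + sigma |s| s at every s, including s = 0. On the unit ball
   the span contains g and 2 (grad p (e_i / 2) - g), the columns of the positive
   definite matrix A + (sigma / 2) I, hence everything. On the line through g
   the span is exactly <g, A g>, and on the plane through s1 and s2 it lies in
   <g, A s1, A s2, s1, s2>. *)

Require Import Defs.
From HB Require Import structures.
From mathcomp Require Import all_boot all_order all_algebra.
From mathcomp Require Import all_classical all_reals all_analysis.
From mathcomp Require Import ring lra.

Set Implicit Arguments.
Unset Strict Implicit.
Unset Printing Implicit Defensive.

Import Order.TTheory GRing.Theory Num.Theory.
Import numFieldNormedType.Exports.

Local Open Scope classical_set_scope.
Local Open Scope ring_scope.

(** * Linear spans as finite-dimensional subspaces *)

Section LinearSpan.
Context {R : realType} {n : nat}.
Implicit Types (W : set 'cV[R]_n) (U V : {vspace 'cV[R]_n}).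

Lemma lin_span_sub W V : (forall w, W w -> w \in V) ->
  forall v, lin_span W v -> v \in V.
Proof.
move=> WV v [k [a [u [Wu ->]]]].
by apply: memv_suml => i _; apply/memvZ/WV.
Qed.

Lemma sub_lin_span W w : W w -> lin_span W w.
Proof.
move=> Ww; exists 1%N, (fun=> 1), (fun=> w); split=> //.
by rewrite big_ord1 scale1r.
Qed.

Lemma lin_spanS W W' : W `<=` W' -> lin_span W `<=` lin_span W'.
Proof.
by move=> WW' v [k [a [u [Wu ->]]]]; exists k, a, u; split=> // i; apply: WW'.
Qed.

Lemma lin_spanD W v w : lin_span W v -> lin_span W w -> lin_span W (v + w).
Proof.
move=> [k [a [u [Wu ->]]]] [l [b [t [Wt ->]]]].
exists (k + l)%N,
  (fun i => match fintype.split i with inl j => a j | inr j => b j end),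
  (fun i => match fintype.split i with inl j => u j | inr j => t j end); split.
  by move=> i; case: (fintype.split i).
rewrite big_split_ord /=; congr (_ + _); apply: eq_bigr => i _.
  by rewrite (unsplitK (inl i)).
by rewrite (unsplitK (inr i)).
Qed.

Lemma lin_spanZ W c v : lin_span W v -> lin_span W (c *: v).
Proof.
move=> [k [a [u [Wu ->]]]]; exists k, (fun i => c * a i), u; split=> //.
by rewrite scaler_sumr; apply: eq_bigr => i _; rewrite scalerA.
Qed.

(* The witness is a subspace of maximal dimension inside the span. *)
Lemma lin_span_vspace W :
  exists U, lin_span W = [set v | v \in U].
Proof.
pose P d := `[< exists U, \dim U = d /\ forall v, v \in U -> lin_span W v >].
have exP : exists d, P d.
  exists 0%N; apply/asboolP; exists 0%VS; split=> [|v]; first exact: dimv0.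
  rewrite memv0 => /eqP ->; exists 0%N, (fun=> 0), (fun=> 0); split=> [[]//|].
  by rewrite big_ord0.
have bP d : P d -> (d <= \dim {:'cV[R]_n})%N.
  by move=> /asboolP[U [<- _]]; apply/dimvS/subvf.
case: (ex_maxnP exP bP) => d /asboolP[U [dU UW]] dmax.
exists U; apply/seteqP; split=> v /=; last exact: UW.
move=> Wv; have: P (\dim (U + <[v]>)%VS).
  apply/asboolP; exists (U + <[v]>)%VS; split=> // x /memv_addP[y yU [z]].
  move=> /vlineP[c ->] ->; apply: lin_spanD; first exact: UW.
  exact: lin_spanZ.
move=> /dmax; rewrite -dU => dle.
have /eqP -> : U == (U + <[v]>)%VS by rewrite eqEdim addvSl dle.
by rewrite (subvP (addvSr _ _)) ?memv_line.
Qed.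

(** The isomorphism sends a coordinate vector to the corresponding combination of [vbasis U];
    freeness gives injectivity, generation gives surjectivity. *)
Lemma vspace_isomorphic_to_Rd U : isomorphic_to_Rd [set v | v \in U] (\dim U).
Proof.
pose phi (x : 'cV[R]_(\dim U)) : 'cV[R]_n := \sum_i x i 0 *: (vbasis U)`_i.
have phi_lin : linear phi.
  move=> c x y; rewrite /phi scaler_sumr -big_split /=; apply: eq_bigr => i _.
  by rewrite !mxE scalerDl scalerA.
pose L := GRing.isLinear.Build _ _ _ _ phi phi_lin.
pose Phi : {linear 'cV[R]_(\dim U) -> 'cV[R]_n} := HB.pack phi L.
have fU : free (vbasis U) := basis_free (vbasisP U).
exists Phi; split.
- move=> x _ /=; apply: memv_suml => i _; apply/memvZ/vbasis_mem.
  by rewrite mem_nth ?size_tuple.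
- move=> x y _ _ /= xy; apply/colP => i.
  by rewrite -(coord_sum_free (fun i => x i 0) i fU)
    -(coord_sum_free (fun i => y i 0) i fU); congr (coord _ _ _).
- move=> v /= vU; exists (\col_i coord (vbasis U) i v) => //=.
  by rewrite /phi [RHS](coord_vbasis vU); apply: eq_bigr => i _; rewrite mxE.
Qed.

(** Reduces a dimension bound on a span to exhibiting one subspace that contains the generators. *)
Lemma lin_span_isomorphic_to_Rd W V : (forall w, W w -> w \in V) ->
  exists d, (d <= \dim V)%N /\ isomorphic_to_Rd (lin_span W) d.
Proof.
move=> WV; have [U WE] := lin_span_vspace W; exists (\dim U); split.
  apply/dimvS/subvP => v vU; apply: (lin_span_sub WV).
  by rewrite WE.
by rewrite WE; exact: vspace_isomorphic_to_Rd.
Qed.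

End LinearSpan.

(** * The Euclidean norm and the gradient of the cubic model *)

Section CubicModel.
Context {R : realType} {n : nat}.
Implicit Types (s v g : 'cV[R]_n) (B : 'M[R]_n).

Lemma enorm_ge0 v : 0 <= enorm v. Proof. exact: sqrtr_ge0. Qed.

Lemma sqr_enorm v : enorm v ^+ 2 = (v^T *m v) 0 0.
Proof.
rewrite sqr_sqrtr; last by apply: sumr_ge0 => i _; exact: sqr_ge0.
by rewrite mxE; apply: eq_bigr => i _; rewrite mxE expr2.
Qed.

Lemma delta_mulE v (i : 'I_n) : ((delta_mx i 0 : 'cV[R]_n)^T *m v) 0 0 = v i 0.
Proof. by rewrite trmx_delta -rowE mxE. Qed.

Lemma mul_deltaE v (i : 'I_n) : (v^T *m (delta_mx i 0 : 'cV[R]_n)) 0 0 = v i 0.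
Proof. by rewrite -colE !mxE. Qed.

Lemma addmxE (p q : nat) (X Y : 'M[R]_(p, q)) i j : (X + Y) i j = X i j + Y i j.
Proof. by rewrite mxE. Qed.

Lemma scalemxE (p q : nat) a (X : 'M[R]_(p, q)) i j : (a *: X) i j = a * X i j.
Proof. by rewrite mxE. Qed.

Lemma enorm0 : enorm (0 : 'cV[R]_n) = 0.
Proof. by apply/eqP; rewrite -sqrf_eq0 sqr_enorm mulmx0 mxE. Qed.

Lemma enorm_half_delta (i : 'I_n) :
  enorm (2^-1 *: delta_mx i 0 : 'cV[R]_n) = 2^-1.
Proof.
apply/eqP; rewrite -(@eqrXn2 _ 2) ?enorm_ge0 ?invr_ge0 //; apply/eqP.
rewrite sqr_enorm -scalemxAr scalemxE mul_deltaE scalemxE mxE !eqxx mulr1 expr2 //.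
Qed.

(** Exact expansion for the difference quotient in direction [i]. Since [B] is not assumed
    symmetric, the two cross terms combine into [B + B^T]. *)
Lemma quad_shift B (h : R) s i :
  ((h *: delta_mx i 0 + s)^T *m B *m (h *: delta_mx i 0 + s)) 0 0 =
  (s^T *m B *m s) 0 0 + h * ((B + B^T) *m s) i 0 + h ^+ 2 * B i i.
Proof.
set e := delta_mx i 0.
have -> : (h *: e + s)^T = h *: e^T + s^T by apply/matrixP => k j; rewrite !mxE.
rewrite !mulmxDl !mulmxDr -!scalemxAl -!scalemxAr !addmxE !scalemxE.
have -> : (e^T *m B *m s) 0 0 = (B *m s) i 0 by rewrite -mulmxA delta_mulE.
have -> : (s^T *m B *m e) 0 0 = (B^T *m s) i 0.
  by rewrite -mul_deltaE trmx_mul trmxK.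
have -> : (e^T *m B *m e) 0 0 = B i i by rewrite -mulmxA delta_mulE -colE mxE.
ring.
Qed.

(** The squared norm is the quadratic form of the identity, so this is [quad_shift] with [B] equal
    to [1%:M]. *)
Lemma sqr_enorm_shift (h : R) s i :
  enorm (h *: delta_mx i 0 + s) ^+ 2 = enorm s ^+ 2 + 2 * h * s i 0 + h ^+ 2.
Proof.
have := quad_shift 1%:M h s i.
rewrite mulmx1 -!sqr_enorm => ->.
rewrite trmx1 mulmxDl mul1mx mulmx1 -sqr_enorm !mxE eqxx /=; ring.
Qed.

Lemma coord_le_enorm s i : `|s i 0| <= enorm s.
Proof.
rewrite -sqrtr_sqr ler_wsqrtr // (bigD1 i) //= lerDl.
by apply: sumr_ge0 => j _; exact: sqr_ge0.
Qed.

(** A reverse triangle inequality, obtained by comparing squares: by [coord_le_enorm], the cross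
    term [2 * h * s i 0] is at most [2 * |h| * enorm s] in absolute value. *)
Lemma enorm_shift_dist (h : R) s i :
  `|enorm (h *: delta_mx i 0 + s) - enorm s| <= `|h|.
Proof.
set N := enorm _; set M := enorm s.
have E : N ^+ 2 = M ^+ 2 + 2 * h * s i 0 + h ^+ 2 := sqr_enorm_shift h s i.
have N0 : 0 <= N := enorm_ge0 _.
have M0 : 0 <= M := enorm_ge0 _.
have hs : `|h * s i 0| <= `|h| * M.
  by rewrite normrM ler_wpM2l ?coord_le_enorm.
have h2 : h ^+ 2 = `|h| ^+ 2 by rewrite real_normK ?num_real.
move: hs; rewrite ler_norml => /andP[hs1 hs2].
rewrite ler_distl; have h0 := normr_ge0 h; apply/andP; split.
  case: (leP M `|h|) => Mh; first by lra.
  rewrite -ler_sqr ?nnegrE //; last by lra.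
  by rewrite E h2; lra.
by rewrite -ler_sqr ?nnegrE ?addr_ge0 // E h2; lra.
Qed.

(** Turns an explicit error bound for a difference quotient into its limit. Restricting to
    [|h| <= 1] lets higher powers of [h] be absorbed into the linear bound. *)
Lemma cvg_of_linear_error (phi : R -> R) (l K : R) :
  (forall h, h != 0 -> `|h| <= 1 -> `|phi h - l| <= K * `|h|) ->
  phi h @[h --> 0^'] --> l.
Proof.
move=> phiK; apply/(@cvgrPdist_le R R) => e e0.
have K1 : 0 < `|K| + 1 by rewrite ltr_wpDl.
have d0 : 0 < Num.min 1 (e / (`|K| + 1)) by rewrite lt_min ltr01 divr_gt0.
exists (Num.min 1 (e / (`|K| + 1))) => //= h /=.
rewrite sub0r normrN lt_min => /andP[h1 he] hn0.
rewrite distrC (le_trans (phiK h hn0 (ltW h1)))//.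
apply: (@le_trans _ _ ((`|K| + 1) * `|h|)).
  by rewrite ler_wpM2r// (le_trans (ler_norm K))// lerDl.
by rewrite mulrC -ler_pdivlMr// ltW.
Qed.

(** Each partial derivative is computed from its difference quotient with an error linear in [h].
    The estimate never divides by [enorm s], so [s = 0] needs no separate case. *)
Lemma gradient_cubic_model (c sigma : R) g B s :
  gradient (cubic_model c g B sigma) s =
  g + 2^-1 *: ((B + B^T) *m s) + (sigma * enorm s) *: s.
Proof.
apply/colP => i; rewrite mxE.
set l := RHS.
have lE : l = g i 0 + 2^-1 * ((B + B^T) *m s) i 0 + sigma * enorm s * s i 0.
  by rewrite /l !addmxE !scalemxE.
apply: cvg_lim => //.
pose M := enorm s.
(* The first summand bounds the second-order term of the quadratic form, the second the remainder of
   the cubic term; the latter is generous, since [3 * M + 1] would suffice in the parentheses. *)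
pose K := `|2^-1 * B i i| + `|sigma / 3| * (`|M| * 2 + (3 * `|M| + 2)).
apply: (@cvg_of_linear_error _ _ K) => h h0 h1.
rewrite lE /cubic_model /= quad_shift.
rewrite mulmxDr -scalemxAr addmxE scalemxE mul_deltaE.
set N := enorm (_ + _); set q := (s^T *m B *m s) 0 0; set b := (_ *m s) i 0.
set gs := (_ *m s) 0 0; rewrite -/M.
have NE : N ^+ 2 = M ^+ 2 + 2 * h * s i 0 + h ^+ 2 := sqr_enorm_shift h s i.
have Nd : `|N - M| <= `|h| := enorm_shift_dist h s i.
(* [D] is what remains of [(N ^+ 3 - M ^+ 3) / h] after removing its limit [3 * M * s i 0]. *)
pose D := (3 / 2) * M * h + h^-1 * ((N - M) ^+ 2 * (N + M / 2)).
have -> : h^-1 *: (c + (h * g i 0 + gs) + 2^-1 * (q + h * b + h ^+ 2 * B i i)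
    + sigma / 3 * N ^+ 3 - (c + gs + 2^-1 * q + sigma / 3 * M ^+ 3))
    - (g i 0 + 2^-1 * b + sigma * M * s i 0) =
    h * (2^-1 * B i i) + sigma / 3 * D.
  (* [N^3 - M^3 - (3/2) M (N^2 - M^2) = (N - M)^2 (N + M/2)], which
     avoids differentiating the square root at [0] *)
  have N3 : N ^+ 3 = M ^+ 3 + 3 / 2 * M * (2 * h * s i 0 + h ^+ 2)
                     + (N - M) ^+ 2 * (N + M / 2).
    have -> : 2 * h * s i 0 + h ^+ 2 = N ^+ 2 - M ^+ 2 by rewrite NE; ring.
    by field.
  rewrite N3 /D /GRing.scale /=; field; exact: h0.
have M0 : 0 <= M := enorm_ge0 _.
have hp : 0 < `|h| by rewrite normr_gt0.
have NM : `|N + M / 2| <= 3 / 2 * M + 1.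
  have -> : N + M / 2 = (N - M) + 3 / 2 * M by field.
  rewrite (le_trans (ler_normD _ _))// addrC lerD//; last exact: le_trans Nd h1.
  by rewrite ger0_norm// mulr_ge0.
(* The square [(N - M) ^+ 2] is at most [h ^+ 2], so one factor [|h|] survives the division by
   [h]. *)
have D2 : `|h^-1 * ((N - M) ^+ 2 * (N + M / 2))| <= (3 / 2 * M + 1) * `|h|.
  rewrite normrM normfV [`|_ ^+ 2 * _|]normrM [`|_ ^+ 2|]normrX mulrA [leRHS]mulrC ler_pM //.
  by rewrite mulrC ler_pdivrMr// -expr2 lerXn2r ?nnegrE.
have DK : `|D| <= (`|M| * 2 + (3 * `|M| + 2)) * `|h|.
  rewrite (le_trans (ler_normD _ _))// normrM (@ger0_norm _ (3/2 * M)) ?mulr_ge0//.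
  rewrite (ger0_norm M0).
  have Mh : 0 <= M * `|h| by rewrite mulr_ge0.
  by lra.
rewrite (le_trans (ler_normD _ _))// /K mulrDl lerD//.
  by rewrite normrM mulrC.
by rewrite normrM -mulrA ler_wpM2l.
Qed.

(** If the matrix were singular, a nonzero row [w] would annihilate it, yet its quadratic form at
    [w] is that of [B], which is positive, plus [t] times the squared norm of [w]. *)
Lemma positive_definite_unitmx B (t : R) : positive_definite B -> 0 <= t ->
  2^-1 *: (B + B^T) + t%:M \in unitmx.
Proof.
move=> Bpos t0; rewrite unitmxE unitfE; apply/negP => /det0P[w wn0 wA].
have vn0 : w^T != 0 by rewrite -(inj_eq trmx_inj) trmxK trmx0.
have q0 : 0 < (w *m B *m w^T) 0 0 by have := Bpos _ vn0; rewrite trmxK.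
(* A one-by-one matrix equals its transpose, so symmetrizing [B] leaves its quadratic form
   unchanged. *)
have qT : (w *m B^T *m w^T) 0 0 = (w *m B *m w^T) 0 0.
  have -> : w *m B^T *m w^T = (w *m B *m w^T)^T
    by rewrite !trmx_mul trmxK mulmxA.
  by rewrite [LHS]mxE.
have n0 : 0 <= (w *m w^T) 0 0 by rewrite -{1}[w]trmxK -sqr_enorm sqr_ge0.
have : ((w *m (2^-1 *: (B + B^T) + t%:M)) *m w^T) 0 0 = 0.
  by rewrite wA mul0mx mxE.
rewrite mulmxDr mul_mx_scalar -scalemxAr mulmxDr mulmxDl -!scalemxAl mulmxDl.
rewrite !addmxE !scalemxE !addmxE qT => E.
have : 0 <= t * (w *m w^T) 0 0 by rewrite mulr_ge0.
by lra.
Qed.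

End CubicModel.

(** * The spans of model gradients over the ball, a line, two lines and a plane *)

Theorem theorem2p2 (R : realType) (n : nat) (f : 'cV[R]_n -> R)
    (xk g : 'cV[R]_n) (B : 'M[R]_n) (sigma : R) (s1 s2 : 'cV[R]_n)
    (p : 'cV[R]_n -> R)
    (f_diff2 : twice_differentiable f xk)
    (gE : g = gradient f xk) (g_neq0 : g != 0)
    (BE : B = hessian f xk) (B_posdef : positive_definite B)
    (sigma_ge0 : 0 <= sigma)
    (pE : p = cubic_model (f xk) g B sigma)
    (s1_unit : enorm s1 = 1) (s2_unit : enorm s2 = 1) (s12_neq : s1 != s2) :
  [/\ gradient_span p (eball 0 1) = [set: 'cV[R]_n],
      isomorphic_to_Rd (gradient_span p (lin_span [set gradient p 0])) 1 \/
      isomorphic_to_Rd (gradient_span p (lin_span [set gradient p 0])) 2,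
      exists d : nat, (d <= 5)%N /\
        isomorphic_to_Rd
          (gradient_span p (lin_span [set s1] `|` lin_span [set s2])) d
    & exists d : nat, (d <= 5)%N /\
        isomorphic_to_Rd (gradient_span p (lin_span [set s1; s2])) d].
Proof.
pose A := 2^-1 *: (B + B^T).
have gradp s : gradient p s = g + A *m s + (sigma * enorm s) *: s.
  by rewrite pE gradient_cubic_model scalemxAl.
have gradp0 : gradient p 0 = g by rewrite gradp mulmx0 scaler0 !addr0.
(* At [s = a *: s1 + b *: s2] the nonlinear factor [enorm s] only scales [s], so five fixed vectors
   suffice. This serves both the two lines and the plane. *)
have gradp_plane s : lin_span [set s1; s2] s ->
    gradient p s \in <<[:: g; A *m s1; A *m s2; s1; s2]>>%VS.
  move=> hs; have : s \in <<[:: s1; s2]>>%VS.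
    apply: lin_span_sub hs => w [] ->; apply: memv_span;
      by rewrite !inE eqxx ?orbT.
  have X u : u \in [:: g; A *m s1; A *m s2; s1; s2] ->
    u \in <<[:: g; A *m s1; A *m s2; s1; s2]>>%VS by exact: memv_span.
  rewrite span_cons span_seq1 => /memv_addP[_ /vlineP[a ->]].
  move=> [_ /vlineP[b ->] ->]; rewrite gradp mulmxDr -!scalemxAr.
  rewrite !(rpredD, rpredZ) // X // !inE eqxx ?orbT //.
split.
- have [U UE] := lin_span_vspace (gradient p @` eball 0 1).
  have inU s : enorm s < 1 -> gradient p s \in U.
    move=> hs; have : gradient_span p (eball 0 1) (gradient p s).
      by apply: sub_lin_span; exists s => //; rewrite /eball /= subr0.
    by rewrite /gradient_span UE.
  have gU : g \in U by rewrite -gradp0 inU // enorm0 ltr01.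
  pose M := A + (sigma / 2)%:M.
  have MU : M \in unitmx by apply: positive_definite_unitmx; rewrite // divr_ge0.
  (* Points of norm [1/2] lie inside the open ball and share one value of [enorm], so the same shift
     [sigma / 2] occurs in every column. *)
  have colMU i : col i M \in U.
    have := inU (2^-1 *: delta_mx i 0); rewrite enorm_half_delta.
    move=> /(_ ltac:(lra)); rewrite gradp enorm_half_delta => hU.
    have -> : col i M = 2 *: (g + A *m (2^-1 *: delta_mx i 0)
        + (sigma * 2^-1) *: (2^-1 *: delta_mx i 0) - g).
      rewrite colE mulmxDl mul_scalar_mx -scalemxAr.
      by apply/colP => j; rewrite !mxE; field.
    by apply/memvZ/memvB.
  rewrite /gradient_span UE; apply/seteqP; split=> // v _ /=.
  (* Invertibility of [M] writes [v] as [M *m w], a combination of columns already in [U]. *)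
  rewrite -[v](mulKVmx MU); set w := invmx M *m v.
  have -> : M *m w = \sum_i w i 0 *: col i M.
    apply/colP => j; rewrite mxE summxE; apply: eq_bigr => i _.
    by rewrite !mxE mulrC.
  by apply: memv_suml => i _; apply/memvZ/colMU.
- have [U UE] := lin_span_vspace (gradient p @` lin_span [set gradient p 0]).
  have UT : U = <<[:: g; A *m g]>>%VS.
    (* Two multiples of [g] are enough: [c = 0] yields [g], and [c = 1] yields [A *m g] modulo
       [g]. *)
    have inU c : gradient p (c *: g) \in U.
      have : gradient_span p (lin_span [set gradient p 0]) (gradient p (c *: g)).
        apply: sub_lin_span; exists (c *: g) => //.
        by rewrite -gradp0; apply/lin_spanZ/sub_lin_span.
      by rewrite /gradient_span UE.
    have gU : g \in U by have := inU 0; rewrite scale0r gradp0.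
    have gS : g \in <<[:: g; A *m g]>>%VS by rewrite memv_span ?inE ?eqxx.
    have AS : A *m g \in <<[:: g; A *m g]>>%VS.
      by rewrite memv_span ?inE ?eqxx ?orbT.
    apply/eqP; rewrite eqEsubv; apply/andP; split.
      apply/subvP => v vU; have : [set v | v \in U] v by [].
      rewrite -UE; apply: lin_span_sub => _ [s hs <-]; rewrite gradp.
      have /vlineP[c ->] : s \in <[g]>%VS.
        by apply: lin_span_sub hs => w ->; rewrite gradp0 memv_line.
      by rewrite -scalemxAr !(rpredD, rpredZ).
    apply/span_subvP => w; rewrite !inE => /orP[/eqP -> // | /eqP ->].
    have -> : A *m g = gradient p (1 *: g) - g - (sigma * enorm g) *: g.
      by rewrite scale1r gradp addrAC addrK addrAC subrr add0r.
    by rewrite !rpredB ?rpredZ.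
  rewrite /gradient_span UE.
  (* The hypothesis [g != 0] excludes dimension zero; two generators exclude anything above two. *)
  have U1 : (0 < \dim U)%N.
    rewrite lt0n dimv_eq0 UT; apply: contraNneq g_neq0 => U0.
    by rewrite -memv0 -U0 memv_span ?inE ?eqxx.
  have U2 : (\dim U <= 2)%N by rewrite UT; exact: dim_span.
  have := vspace_isomorphic_to_Rd U.
  by case: (\dim U) U1 U2 => [|[|[|]]] // _ _; [left | right].
- have [|d [dle dS]] := @lin_span_isomorphic_to_Rd _ _
    (gradient p @` (lin_span [set s1] `|` lin_span [set s2]))
    <<[:: g; A *m s1; A *m s2; s1; s2]>>%VS.
    move=> _ [s hs <-]; apply: gradp_plane.
    (* Each of the two lines lies in the plane, so the bound for the plane applies. *)
    case: hs; apply: lin_spanS => w ->; [by left | by right].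
  by exists d; split=> //; apply: leq_trans dle (dim_span _).
- have [|d [dle dS]] := @lin_span_isomorphic_to_Rd _ _
    (gradient p @` lin_span [set s1; s2])
    <<[:: g; A *m s1; A *m s2; s1; s2]>>%VS.
    by move=> _ [s hs <-]; exact: gradp_plane.
  by exists d; split=> //; apply: leq_trans dle (dim_span _).
Qed.
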